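(* Let $(X,f_{1,\infty})$ be a nonautonomous dynamical system, and let $K$ be a nonempty $f_{1,\infty}$-invariant subset of $X$, i.e. $f_i^{-1}(K)=K$ for all $i\ge1$. Then for any $1\le i\le j<\infty$, $$\overline{D}_K(f_{i,\infty})\le\overline{D}_K(f_{j,\infty}),\qquad \underline{D}_K(f_{i,\infty})\le\underline{D}_K(f_{j,\infty}).$$
   Context: A nonautonomous dynamical system $(X,f_{1,\infty})$ consists of a compact topological space $X$ and a sequence $f_{1,\infty}=(f_i)_{i\ge 1}$ of continuous maps $f_i:X\to X$. For $i\ge1$, $f_{i,\infty}$ denotes the shifted sequence $(f_i,f_{i+1},f_{i+2},\dots)$. Upper and lower topological entropy dimension of a sequence $g_{1,\infty}=(g_i)_{i\ge1}$ of continuous selfmaps of $X$ on nonempty $K\subseteq X$ (applied above to $g_{1,\infty}=f_{i,\infty}$ and $f_{j,\infty}$). Put $g_1^0=\mathrm{id}_X$, $g_1^j=g_j\circ\cdots\circ g_1$. For a finite open cover $\mathcal{U}$ of $X$ let $\mathcal{U}_1^n$ be the cover of all sets $\bigcap_{j=0}^{n-1}(g_1^j)^{-1}(U_j)$ with $U_j\in\mathcal{U}$, and let $\mathcal{N}(\mathcal{U}_1^n|_K)$ be the minimal number of members of $\{V\cap K: V\in\mathcal{U}_1^n\}$ needed to cover $K$. For $s>0$ set $\overline{h}_K(g_{1,\infty},s)=\sup_{\mathcal{U}}\limsup_{n\to\infty}\frac{1}{n^s}\log\mathcal{N}(\mathcal{U}_1^n|_K)$ and $\underline{h}_K(g_{1,\infty},s)=\sup_{\mathcal{U}}\liminf_{n\to\infty}\frac{1}{n^s}\log\mathcal{N}(\mathcal{U}_1^n|_K)$,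 suprema over all finite open covers of $X$. Then $\overline{D}_K(g_{1,\infty})=\inf\{s>0:\overline{h}_K(g_{1,\infty},s)=0\}=\sup\{s>0:\overline{h}_K(g_{1,\infty},s)=\infty\}$ and $\underline{D}_K(g_{1,\infty})=\inf\{s>0:\underline{h}_K(g_{1,\infty},s)=0\}=\sup\{s>0:\underline{h}_K(g_{1,\infty},s)=\infty\}$, with $\inf\emptyset=+\infty$ and $\sup\emptyset=0$. *)

(* Defs.v *)
From mathcomp Require Import all_boot all_order all_algebra.
From mathcomp Require Import all_classical all_reals all_analysis.
Set Implicit Arguments.
Unset Strict Implicit.
Unset Printing Implicit Defensive.
Import Order.TTheory GRing.Theory Num.Theory.
Import numFieldNormedType.Exports.
Local Open Scope classical_set_scope.
Local Open Scope ring_scope.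

(* A sequence (g_k)_{k >= 1} of selfmaps is a function [g : nat -> X -> X] whose
   value at index 0 is never used. *)

(* The k-th term of f_{i,oo} is f_{i + k - 1}, for i, k >= 1. *)
Definition shift_seq (X : Type) (f : nat -> X -> X) (i : nat) : nat -> X -> X :=
  fun k => f (i + k).-1.

Fixpoint seq_iter (X : Type) (g : nat -> X -> X) (j : nat) : X -> X :=
  if j is j'.+1 then g j'.+1 \o seq_iter g j' else id.

Definition finite_open_cover (X : topologicalType) (U : set (set X)) : Prop :=
  [/\ finite_set U, U `<=` open & cover U id = [set: X]].

Definition cover_join (X : Type) (g : nat -> X -> X) (U : set (set X)) (n : nat) :
    set (set X) :=
  [set V | exists W : nat -> set X, (forall j, (j < n)%N -> U (W j)) /\
     V = \bigcap_(j in `I_n) (seq_iter g j @^-1` W j)].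

Definition trace (X : Type) (K : set X) (C : set (set X)) : set (set X) :=
  [set V `&` K | V in C].

Definition coverable_by (X : Type) (C : set (set X)) (K : set X) (k : nat) : Prop :=
  exists S : set (set X), [/\ S `<=` C, (S #= `I_k)%card & K `<=` cover S id].

(* The default value 0 of [xget] is only returned when no finite subfamily of C
   covers K; this does not happen for the trace of a [cover_join] of a finite
   cover. *)
Definition cover_number (X : Type) (C : set (set X)) (K : set X) : nat :=
  xget 0%N [set k | coverable_by C K k /\
                    forall m, coverable_by C K m -> (k <= m)%N].

(* The n-th term of the limits; the value at n = 0 is irrelevant to them. *)
Definition entropy_rate (R : realType) (X : topologicalType)
    (K : set X) (g : nat -> X -> X) (s : R) (U : set (set X)) (n : nat) : \bar R :=
  (ln (cover_number (trace K (cover_join g U n)) K)%:R / n%:R `^ s)%:E.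

Definition upper_entropy (R : realType) (X : topologicalType)
    (K : set X) (g : nat -> X -> X) (s : R) : \bar R :=
  ereal_sup [set limn_esup (entropy_rate K g s U) | U in @finite_open_cover X].

Definition lower_entropy (R : realType) (X : topologicalType)
    (K : set X) (g : nat -> X -> X) (s : R) : \bar R :=
  ereal_sup [set limn_einf (entropy_rate K g s U) | U in @finite_open_cover X].

(* The dimensions are defined as inf {s > 0 : h(s) = 0}, which is also
   sup {s > 0 : h(s) = oo}; [ereal_inf] of the empty set is +oo. *)
Definition upper_entropy_dim (R : realType) (X : topologicalType)
    (K : set X) (g : nat -> X -> X) : \bar R :=
  ereal_inf [set s%:E | s in [set s : R | 0 < s /\ upper_entropy K g s = 0%E]].

Definition lower_entropy_dim (R : realType) (X : topologicalType)
    (K : set X) (g : nat -> X -> X) : \bar R :=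
  ereal_inf [set s%:E | s in [set s : R | 0 < s /\ lower_entropy K g s = 0%E]].

(* Main.v *)
Require Import Defs.
From mathcomp Require Import all_boot all_order all_algebra.
From mathcomp Require Import all_classical all_reals all_analysis.
Set Implicit Arguments.
Unset Strict Implicit.
Unset Printing Implicit Defensive.
Import Order.TTheory GRing.Theory Num.Theory.
Local Open Scope classical_set_scope.
Local Open Scope ring_scope.

(** Write g = f_{i,oo}, so that f_{i+1,oo} is the tail [g \o succn].  A member
    of the (n+1)-st join of a cover U along g is A meet g_1^{-1}(V) with A in U
    and V in the n-th join along the tail.  Since g_1 maps K into K, pulling
    back a subfamily covering K gives a family covering K, and meeting it with
    the members of U costs a factor #U only:
      N(U_1^{n+1}(g) | K) <= #U * N(U_1^n(tail) | K)
    ([cover_number_joinS]).  After taking logarithms the factor is an additive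
    constant, negligible against n^s because s > 0; as n^s <= (n+1)^s, the rate
    of g at n+1 is eventually at most the rate of the tail at n plus any
    prescribed e > 0 ([entropy_rateS_near]).

    Neither upper nor lower limits see such an error or a shift of the index
    ([limn_esup_le_subseq]), so for each s > 0 both entropies of g are at most
    those of the tail.  Entropies being nonnegative, every s at which the
    entropy of the tail vanishes is one at which that of g vanishes; hence the
    infimum defining the dimension of g is the smaller one.  The theorem
    follows by induction on j - i. *)

(** * Covering numbers of joins *)

Lemma card_setX_le (T1 T2 : pointedType) (A : set T1) (B : set T2) (a b : nat) :
  (A #<= `I_a)%card -> (B #<= `I_b)%card -> (A `*` B #<= `I_(a * b))%card.
Proof.
move=> /pcard_surjP[u uA] /pcard_surjP[v vB]; apply/pcard_surjP.
exists (fun m => (u (m %/ b), v (m %% b)))%N.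
move=> -[x y] [/= /uA[p /= pa <-] /vB[q /= qb <-]].
have b0 : (0 < b)%N by apply: leq_ltn_trans qb.
exists (p * b + q)%N => /=.
  by rewrite (@leq_trans (p.+1 * b)) ?leq_mul2r ?pa ?orbT// mulSn addnC ltn_add2r.
by rewrite divnMDl// modnMDl divn_small// modn_small// addn0.
Qed.

Section CoverNumber.
Variable X : Type.
Implicit Types (C U : set (set X)) (K : set X) (g : nat -> X -> X).

Lemma coverable_by_le C K (S : set (set X)) m :
  S `<=` C -> K `<=` cover S id -> (S #<= `I_m)%card ->
  exists2 k, (k <= m)%N & coverable_by C K k.
Proof.
move=> SC KS Sm; have /finite_setP[k Sk] := card_le_finite Sm (finite_II m).
by exists k; [rewrite -card_le_II -(card_le_eql Sk) | exists S].
Qed.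

Lemma cover_number_min C K k : coverable_by C K k ->
  coverable_by C K (cover_number C K) /\ (cover_number C K <= k)%N.
Proof.
move=> Ck.
have ex : exists n, `[< coverable_by C K n >] by exists k; apply/asboolP.
have [] : coverable_by C K (cover_number C K) /\
    forall m, coverable_by C K m -> (cover_number C K <= m)%N.
  apply: (@xgetPex _ 0%N [set n | coverable_by C K n /\
    forall m, coverable_by C K m -> (n <= m)%N]).
  case: (ex_minnP ex) => n /asboolP Cn minn; exists n; split => // m Cm.
  by apply: minn; apply/asboolP.
by move=> ? min; split => //; apply: min.
Qed.

Lemma seq_iterSr g n x : seq_iter g n.+1 x = seq_iter (g \o succn) n (g 1%N x).
Proof. by elim: n => //= n ->. Qed.

(** The key count: given k traces covering K for the tail, the sets
    A meet g_1^{-1}(B) meet K, with A in U and B one of these traces, are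
    traces of members of the longer join, and they cover K since each x in K
    lies in some A while g_1 x lies in some B. *)
Lemma coverable_cover_joinS g U K c n k :
  cover U id = [set: X] -> (U #<= `I_c)%card -> K `<=` g 1%N @^-1` K ->
  coverable_by (trace K (cover_join (g \o succn) U n)) K k ->
  exists2 k', (k' <= c * k)%N & coverable_by (trace K (cover_join g U n.+1)) K k'.
Proof.
move=> coverU Uc gK [S0 [SC Sk KS]].
pose h (AB : set X * set X) := AB.1 `&` g 1%N @^-1` AB.2 `&` K.
apply: (@coverable_by_le _ _ [set h AB | AB in U `*` S0]).
- move=> _ [[A B] [/= UA /SC[_ [W [UW ->]] <-]] <-].
  exists (A `&` g 1%N @^-1`
            (\bigcap_(j in `I_n) (seq_iter (g \o succn) j @^-1` W j))).
    exists (fun j => if j is j'.+1 then W j' else A); split.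
      by case=> [//|j]; apply: UW.
    apply/seteqP; split => x.
      by move=> [Ax gx] [//|j] jn; have := gx j jn; rewrite /preimage/= -seq_iterSr.
    move=> Wx; split; first exact: (Wx 0%N).
    by move=> j jn; rewrite /preimage/= -seq_iterSr; exact: (Wx j.+1 jn).
  (* g_1^{-1}(V meet K) and g_1^{-1}(V) have the same trace on K because g_1
     maps K into K. *)
  apply/seteqP; split => x; last by move=> [[? [? ?]] ?].
  by move=> [[? ?] Kx]; do 3![split => //]; exact: gK.
- move=> x Kx; have [B SB Bx] := KS _ (gK _ Kx).
  have [A UA Ax] : cover U id x by rewrite coverU.
  by exists (h (A, B)); [exists (A, B) | split].
- apply: card_le_trans (card_image_le _ _) _; apply: card_setX_le => //.
  by rewrite (card_le_eql Sk).
Qed.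

(** This rules out the junk value of [cover_number], so that the minimality
    characterization [cover_number_min] applies to every join. *)
Lemma coverable_cover_join g U K c n :
  cover U id = [set: X] -> (U #<= `I_c)%card ->
  (forall k, (1 <= k)%N -> K `<=` g k @^-1` K) ->
  exists k, coverable_by (trace K (cover_join g U n)) K k.
Proof.
move=> coverU Uc; elim: n g => [|n IHn] g gK.
  have [|||k _ Ck] := @coverable_by_le (trace K (cover_join g U 0)) K [set K] 1.
  (* The empty intersection makes the 0-th join the trivial cover. *)
  - move=> _ ->; exists setT; last by rewrite setTI.
    by exists (fun=> setT); split => //; rewrite II0 bigcap_set0.
  - by move=> x Kx; exists K.
  - by rewrite (card_le_eql card_set1).
  - by exists k.
have [k Ck] := IHn (g \o succn) (fun k _ => gK k.+1 isT).
by have [k' _ Ck'] := coverable_cover_joinS coverU Uc (gK 1%N isT) Ck; exists k'.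
Qed.

Lemma cover_number_joinS g U K c n :
  cover U id = [set: X] -> (U #<= `I_c)%card ->
  (forall k, (1 <= k)%N -> K `<=` g k @^-1` K) ->
  (cover_number (trace K (cover_join g U n.+1)) K <=
     c * cover_number (trace K (cover_join (g \o succn) U n)) K)%N.
Proof.
move=> coverU Uc gK.
have [k /cover_number_min[CN _]] :=
  coverable_cover_join n coverU Uc (fun k (_ : (1 <= k)%N) => gK k.+1 isT).
have [k' k'le Ck'] := coverable_cover_joinS coverU Uc (gK 1%N isT) CN.
by apply: leq_trans k'le; apply: (cover_number_min Ck').2.
Qed.

End CoverNumber.

(** * Limits along the natural numbers *)

Section Limits.
Variable R : realType.

(** Reindexing by phi lets one statement serve both dimensions: phi n = n - 1
    compares upper limits of the rates, and phi n = n + 1 compares upper limits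
    of their opposites, that is, lower limits. *)
Lemma limn_esup_le_subseq (u v : nat -> \bar R) (phi : nat -> nat) :
  phi @ \oo --> \oo ->
  (forall e : R, 0 < e -> \forall n \near \oo, (u n <= v (phi n) + e%:E)%E) ->
  (limn_esup u <= limn_esup v)%E.
Proof.
move=> phioo uv; apply/lee_addgt0Pr => e e0; rewrite -leeBlDr//.
apply: le_ereal_inf_tmp => _ [V /phioo Vphi <-]; rewrite leeBlDr//.
pose A := [set n | V (phi n) /\ (u n <= v (phi n) + e%:E)%E].
apply: (@le_trans _ _ (ereal_sup (u @` A))).
  apply: ereal_inf_lbound; exists A => //.
  by apply: filterI => //; exact: uv.
apply: ge_ereal_sup => _ [n [Vn un] <-]; apply: le_trans un _.
by rewrite leeD2r//; apply: ereal_sup_ubound; exists (phi n).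
Qed.

Lemma near_le_mul_powR (C e s : R) : 0 < e -> 0 < s ->
  \forall n \near \oo, C <= e * n%:R `^ s.
Proof.
move=> e0 s0; near=> n.
(* It suffices that n >= |C / e| ^ (1 / s). *)
rewrite mulrC -ler_pdivrMr//.
apply: (@le_trans _ _ `|C / e|); first exact: ler_norm.
rewrite -[leLHS]powRr1// -[X in _ `^ X <= _](mulVf (lt0r_neq0 s0)) powRrM.
apply: ge0_ler_powR; rewrite ?nnegrE ?powR_ge0//; first exact: ltW.
by near: n; exact: nbhs_infty_ger.
Unshelve. all: by end_near. Qed.

Lemma ln_nat_ge0 n : 0 <= ln (n%:R : R).
Proof. by case: n => [|n]; [rewrite ln0 | rewrite ln_ge0// ler1n]. Qed.

(** The degenerate case m = 0 relies on the convention [ln 0 = 0]. *)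
Lemma ln_nat_le_mul (m c n : nat) : (m <= c * n)%N ->
  ln (m%:R : R) <= ln c%:R + ln n%:R.
Proof.
case: m => [_|m mcn]; first by rewrite ln0// addr_ge0// ln_nat_ge0.
have : (0 < c * n)%N by apply: leq_trans mcn.
rewrite muln_gt0 => /andP[c0 n0].
rewrite -lnM ?posrE ?ltr0n// -natrM ler_ln ?posrE ?ltr0n ?muln_gt0 ?c0//.
by rewrite ler_nat.
Qed.

End Limits.

(** * Entropies and dimensions of a sequence and of its tail *)

Section EntropyRate.
Variables (R : realType) (X : topologicalType) (K : set X).
Implicit Types (g : nat -> X -> X) (U : set (set X)) (s : R).

Lemma entropy_rate_ge0 g s U n : (0 <= entropy_rate K g s U n)%E.
Proof. by rewrite lee_fin divr_ge0 ?powR_ge0 ?ln_nat_ge0. Qed.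

Lemma limn_esup_rate_ge0 g s U : (0 <= limn_esup (entropy_rate K g s U))%E.
Proof.
apply: limf_esup_ge0 => [|n]; last exact: entropy_rate_ge0.
by case=> N _ /(_ N); apply => /=.
Qed.

Lemma limn_einf_rate_ge0 g s U : (0 <= limn_einf (entropy_rate K g s U))%E.
Proof.
rewrite /limn_einf oppe_ge0; apply: (@le_trans _ _
  (ereal_sup ((\- entropy_rate K g s U)%E @` setT))).
  by apply: ereal_inf_lbound; exists setT => //; exact: filterT.
by apply: ge_ereal_sup => _ [n _ <-]; rewrite oppe_le0 entropy_rate_ge0.
Qed.

(** A witness that the suprema defining the entropies are not over the empty
    set, which would make them -oo. *)
Lemma finite_open_cover_setT : finite_open_cover [set [set: X]].
Proof.
split; first exact: finite_set1.
- by move=> _ ->; exact: openT.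
- by apply/seteqP; split => // x _; exists setT.
Qed.

Lemma upper_entropy_ge0 g s : (0 <= upper_entropy K g s)%E.
Proof.
apply: le_trans (limn_esup_rate_ge0 g s [set setT]) _.
by apply: ereal_sup_ubound; exists [set setT] => //; exact: finite_open_cover_setT.
Qed.

Lemma lower_entropy_ge0 g s : (0 <= lower_entropy K g s)%E.
Proof.
apply: le_trans (limn_einf_rate_ge0 g s [set setT]) _.
by apply: ereal_sup_ubound; exists [set setT] => //; exact: finite_open_cover_setT.
Qed.

Variable g : nat -> X -> X.
Hypothesis gK : forall k, (1 <= k)%N -> K `<=` g k @^-1` K.

(** The excess is at most ln #U / n^s, which tends to 0. *)
Lemma entropy_rateS_near s U e : 0 < s -> finite_open_cover U -> 0 < e ->
  \forall n \near \oo, (entropy_rate K g s U n.+1 <=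
                        entropy_rate K (g \o succn) s U n + e%:E)%E.
Proof.
move=> s0 [/finite_setP[c Uc] _ coverU] e0.
near=> n.
have n0 : (0 < n)%N by near: n; exact: nbhs_infty_ge.
have ns0 : 0 < n%:R `^ s :> R by rewrite powR_gt0// ltr0n.
rewrite -EFinD lee_fin.
apply: (@le_trans _ _ (ln (cover_number (trace K (cover_join g U n.+1)) K)%:R
                        / n%:R `^ s)).
  apply: ler_wpM2l; first exact: ln_nat_ge0.
  rewrite lef_pV2 ?posrE ?powR_gt0 ?ltr0n//.
  by apply: ge0_ler_powR; rewrite ?nnegrE ?(ltW s0) ?ler_nat.
rewrite ler_pdivrMr// mulrDl divfK ?gt_eqF// addrC.
apply: (@le_trans _ _ (ln c%:R +
  ln (cover_number (trace K (cover_join (g \o succn) U n)) K)%:R)).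
  apply/ln_nat_le_mul/cover_number_joinS => //.
  by rewrite (card_le_eql Uc) card_le_II.
rewrite lerD2r; near: n; exact: near_le_mul_powR.
Unshelve. all: by end_near. Qed.

Lemma upper_entropy_le_tail s : 0 < s ->
  (upper_entropy K g s <= upper_entropy K (g \o succn) s)%E.
Proof.
move=> s0; apply: ge_ereal_sup => _ [U Ucov <-].
apply: (@le_trans _ _ (limn_esup (entropy_rate K (g \o succn) s U))); last first.
  by apply: ereal_sup_ubound; exists U.
apply: (limn_esup_le_subseq (cvg_subnr 1)) => e e0.
have [N _ HN] := entropy_rateS_near s0 Ucov e0.
exists N.+1 => // -[//|n] /= Nn; rewrite subn1; exact: HN.
Qed.

Lemma lower_entropy_le_tail s : 0 < s ->
  (lower_entropy K g s <= lower_entropy K (g \o succn) s)%E.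
Proof.
move=> s0; apply: ge_ereal_sup => _ [U Ucov <-].
apply: (@le_trans _ _ (limn_einf (entropy_rate K (g \o succn) s U))); last first.
  by apply: ereal_sup_ubound; exists U.
rewrite leeN2; apply: (limn_esup_le_subseq (cvg_addnr 1)) => e e0.
apply: filterS (entropy_rateS_near s0 Ucov e0) => n.
by rewrite addn1 leeNl oppeD// oppeK leeBlDr.
Qed.

Lemma upper_entropy_dim_le_tail :
  (upper_entropy_dim R K g <= upper_entropy_dim R K (g \o succn))%E.
Proof.
rewrite /upper_entropy_dim; apply: ereal_inf_le_tmp => _ [s [s0 hs] <-].
exists s; last reflexivity.
split; first exact: s0.
by apply: le_anti; rewrite upper_entropy_ge0 -[X in (_ <= X)%E]hs upper_entropy_le_tail.
Qed.

Lemma lower_entropy_dim_le_tail :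
  (lower_entropy_dim R K g <= lower_entropy_dim R K (g \o succn))%E.
Proof.
rewrite /lower_entropy_dim; apply: ereal_inf_le_tmp => _ [s [s0 hs] <-].
exists s; last reflexivity.
split; first exact: s0.
by apply: le_anti; rewrite lower_entropy_ge0 -[X in (_ <= X)%E]hs lower_entropy_le_tail.
Qed.

End EntropyRate.

Lemma shift_seqS (X : Type) (f : nat -> X -> X) i :
  shift_seq f i.+1 = shift_seq f i \o succn.
Proof. by apply/funext => k; rewrite /shift_seq /= addnS. Qed.

Theorem theorem3p4 (R : realType) (X : topologicalType)
    (hX : compact [set: X])
    (f : nat -> X -> X) (hf : forall i, (1 <= i)%N -> continuous (f i))
    (K : set X) (hK0 : K !=set0)
    (hK : forall i, (1 <= i)%N -> f i @^-1` K = K)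
    (i j : nat) (hi : (1 <= i)%N) (hij : (i <= j)%N) :
  (upper_entropy_dim R K (shift_seq f i) <=
     upper_entropy_dim R K (shift_seq f j))%E /\
  (lower_entropy_dim R K (shift_seq f i) <=
     lower_entropy_dim R K (shift_seq f j))%E.
Proof.
rewrite -(subnKC hij); elim: (j - i)%N => [|d [IHu IHl]]; first by rewrite addn0.
have invK k : (1 <= k)%N -> K `<=` shift_seq f (i + d) k @^-1` K.
  move=> k1; rewrite /shift_seq hK// -ltnS prednK ?addn_gt0 ?hi//.
  by rewrite -addnA -addn1 leq_add// addn_gt0 k1 orbT.
rewrite addnS shift_seqS; split.
  exact: le_trans IHu (upper_entropy_dim_le_tail _ invK).
exact: le_trans IHl (lower_entropy_dim_le_tail _ invK).
Qed.
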